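(* Let $X$ be a real-valued random variable with distribution function $F$ and finite moments of all positive orders, and suppose that $m_{2k}=\mathbf{E}[X^{2k}]$ satisfies $m_{2k}\ge c\,(2k)^{2(1+\varepsilon)k}$ for $k=1,2,\ldots$, for some positive constants $c$ and $\varepsilon$. Assume further that $X$ has a density function $f$ on $\mathbb{R}$ which is symmetric about zero and satisfies Condition L. Then $X$ is M-indet.
   Context: A random variable $X$ with distribution function $F$ and moments $m_k=\mathbf{E}[X^k]$ is called moment determinate (M-det) if $F$ is the only distribution having the moment sequence $\{m_k\}_{k=1}^\infty$; otherwise it is called moment indeterminate (M-indet). Condition L (for a symmetric density $f(x)$, $x\in\mathbb{R}$): for some fixed $x_0>0$, $f$ is strictly positive and differentiable for $x>x_0$, and the function $L_f(x):=-\dfrac{x f'(x)}{f(x)}$ increases monotonically to $\infty$ as $x\to\infty$, $x>x_0$. *)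

(* Defs.v *)
From HB Require Import structures.
From mathcomp Require Import all_boot all_order all_algebra.
From mathcomp Require Import all_classical all_reals all_analysis.
Set Implicit Arguments.
Unset Strict Implicit.
Unset Printing Implicit Defensive.
Import Order.TTheory GRing.Theory Num.Theory.
Import numFieldNormedType.Exports.
Local Open Scope classical_set_scope.
Local Open Scope ring_scope.

Definition finite_moments (d : measure_display) (T : measurableType d)
    (R : realType) (P : probability T R) (X : T -> R) : Prop :=
  forall k : nat, (0 < k)%N ->
    P.-integrable [set: T] (fun t => (X t ^+ k)%:E).

Definition moment (d : measure_display) (T : measurableType d)
    (R : realType) (P : probability T R) (X : T -> R) (k : nat) : \bar R :=
  'E_P[fun t => X t ^+ k].

(* A distribution is a Borel probability measure [nu] on [R]; its moments are
   those of the identity under [nu]. *)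
Definition moment_determinate (d : measure_display) (T : measurableType d)
    (R : realType) (P : probability T R) (X : {RV P >-> R}) : Prop :=
  forall nu : probability R R,
    finite_moments nu (@idfun R) ->
    (forall k : nat, (0 < k)%N ->
      moment nu (@idfun R) k = moment P X k) ->
    forall A : set R, measurable A -> nu A = distribution P X A.

Definition moment_indeterminate (d : measure_display) (T : measurableType d)
    (R : realType) (P : probability T R) (X : {RV P >-> R}) : Prop :=
  ~ moment_determinate X.

Definition is_density (d : measure_display) (T : measurableType d)
    (R : realType) (P : probability T R) (X : {RV P >-> R}) (f : R -> R)
    : Prop :=
  [/\ measurable_fun [set: R] f,
      (forall x, 0 <= f x) &
      forall A : set R, measurable A ->
        distribution P X A = (\int[lebesgue_measure]_(x in A) (f x)%:E)%E].

Definition L_fun (R : realType) (f : R -> R) (x : R) : R :=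
  - (x * derive1 f x / f x).

(* Monotonicity of the function [L_fun f] is meant in the wide sense. *)
Definition condition_L (R : realType) (f : R -> R) : Prop :=
  exists2 x0 : R, 0 < x0 &
    [/\ (forall x, x0 < x -> 0 < f x /\ derivable f x 1),
        (forall x y, x0 < x -> x <= y -> L_fun f x <= L_fun f y) &
        L_fun f x @[x --> +oo] --> +oo].

(* Main.v *)
Require Import Defs.
From HB Require Import structures.
From mathcomp Require Import all_boot all_order all_algebra.
From mathcomp Require Import all_classical all_reals all_analysis.
From mathcomp Require Import measurable_realfun ring lra.
Set Implicit Arguments.
Unset Strict Implicit.
Unset Printing Implicit Defensive.
Import Order.TTheory GRing.Theory Num.Theory.
Import numFieldNormedType.Exports.
Local Open Scope classical_set_scope.
Local Open Scope ring_scope.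

(** Put [alpha = 1 / (1 + eps) < 1]. The density is perturbed by a non-zero
    function all of whose moments vanish and which is smaller than [f]
    everywhere; this yields a second distribution with the same moments.

    Lower bound on [f] ([density_lower_bound]). Condition L says that
    [- ln (f (e ^ t))] is convex in [t], with slope [L_fun f (e ^ t)]. The
    Legendre transform of this function at [N] is the logarithm of the supremum
    of [x ^ N * f x], which is, up to lower order terms, the logarithm of the
    moment of order [N], hence at least [(1 + eps) * N * ln N]. Transforming
    back, [- ln (f y)] is at most a multiple of [y ^ alpha], up to a logarithm.

    A function without moments ([Rintegral_wave_eq0]). For [0 <= t < pi / 2],
    turning the half-line of integration in the Gamma integral by the angle [t]
    gives
      [int_0^oo s ^ (p - 1) * exp (- s * e ^ (i * t)) ds
         = e ^ (- i * p * t) * Gamma p].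
    If [t = pi * b] with [b < 1 / 2], and [p = (n + 1) / b] for a natural number
    [n], then [p * t] is a multiple of [pi], so that the imaginary part of the
    left-hand side vanishes. With [s = u ^ b], this says that every moment over
    the half-line of [exp (- u ^ b * cos t) * sin (u ^ b * sin t)] vanishes.
    With [u = x ^ 2 - a ^ 2] one gets an even function of [x] which is zero on
    [[- a, a]], whose moments all vanish, and which decays at least like
    [exp (- C * |x| ^ (2 * b))] up to a factor [|x|]. Here [2 * b] can be any
    number below [1]; the choice [alpha < 2 * b] makes the function, after
    scaling, smaller than [f] ([wave_dominated]), with [a] so large that the
    lower bound on [f] holds outside [[- a, a]]; inside, [f] may vanish.

    The rotation of the half-line is done over the reals, by differentiating
    with respect to the angle: the angular derivative of the integrand is an
    exact derivative in the variable of integration. Working on [[a, c]], the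
    integral at the angle [pi * b] is bounded by a boundary term at [c]
    ([truncated_moment_le]), which tends to [0] when [c] tends to infinity. *)

(** * Real powers against exponentials and logarithms *)

Lemma powRD_gt0 (R : realType) (x r s : R) : 0 < x ->
  x `^ (r + s) = x `^ r * x `^ s.
Proof. by move=> x0; rewrite powRD// (gt_eqF x0) implybT. Qed.

Lemma ln_le_powR (R : realType) (y a : R) : 0 < y -> 0 < a ->
  ln y <= a^-1 * y `^ a.
Proof.
move=> y0 a0; rewrite -(ler_pM2l a0) mulrA divff ?gt_eqF// mul1r -ln_powR.
exact/ltW/ln_sublinear/powR_gt0.
Qed.

(** Beyond the point where [y ^ (ga - al)] reaches [A / B] the inequality holds
    without [M]; below it, the left-hand side is bounded. *)
Lemma powR_le_powR_add (R : realType) (al ga A B : R) :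
  0 < al -> al < ga -> 0 <= A -> 0 < B ->
  exists M, forall y, 0 < y -> A * y `^ al <= B * y `^ ga + M.
Proof.
move=> al0 alga A0 B0.
pose r := ga - al; have r0 : 0 < r by rewrite subr_gt0.
have AB0 : 0 <= A / B by rewrite divr_ge0// ltW.
pose y0 := (A / B) `^ (r^-1).
exists (A * y0 `^ al) => y yp.
have yga : y `^ ga = y `^ r * y `^ al.
  by rewrite -powRD_gt0// subrK.
have [yy0|y0y] := leP y y0.
  rewrite -[leLHS]add0r lerD ?(mulr_ge0 (ltW B0)) ?powR_ge0//.
  by rewrite ler_wpM2l// ge0_ler_powR// ?nnegrE ?powR_ge0// ltW.
rewrite -[leLHS]addr0 lerD ?mulr_ge0 ?powR_ge0// yga mulrA ler_wpM2r ?powR_ge0//.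
rewrite -ler_pdivrMl// mulrC.
have -> : A / B = y0 `^ r by rewrite /y0 -powRrM mulVf ?gt_eqF// powRr1.
by rewrite ge0_ler_powR// ?nnegrE ?powR_ge0// ltW.
Qed.

(** [ln y] is dominated by a small power of [y], so this reduces to the
    comparison of two powers in the exponent. *)
Lemma expR_powR_dominates (R : realType) (b C : R) (m : nat) : 0 < b -> 0 < C ->
  exists M, forall y, 0 < y -> y ^+ m * expR (- (y `^ b * C)) <= expR M.
Proof.
move=> b0 C0; pose al := b / 2; have al0 : 0 < al by rewrite divr_gt0.
have alb : al < b by rewrite /al ltr_pdivrMr// ltr_pMr// ltr1n.
have mal : 0 <= m%:R * al^-1 :> R by rewrite mulr_ge0// invr_ge0 ltW.
have [M HM] := powR_le_powR_add al0 alb mal C0.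
exists M => y y0; rewrite -[y ^+ m]lnK ?posrE ?exprn_gt0// lnXn//.
rewrite -expRD ler_expR lerBlDr addrC -mulr_natl mulrC.
rewrite [leRHS]addrC [y `^ b * C]mulrC mulrC addrC.
apply: le_trans (HM _ y0); rewrite -mulrA ler_wpM2l//; exact: ln_le_powR.
Qed.

Lemma powR_expR_cvg0 (R : realType) (b C : R) (m : nat) : 0 < b -> 0 < C ->
  y ^+ m * expR (- (y `^ b * C)) @[y --> +oo] --> (0 : R).
Proof.
move=> b0 C0; have [M HM] := expR_powR_dominates m.+1 b0 C0.
apply/cvgr0Pnorm_le => e e0; near=> y.
have y0 : 0 < y by near: y; exact: nbhs_pinfty_gt.
rewrite ger0_norm ?mulr_ge0 ?expR_ge0 ?exprn_ge0 ?(ltW y0)//.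
rewrite -(ler_pM2l y0) mulrA -exprS; apply: (le_trans (HM _ y0)).
rewrite -ler_pdivrMr//; near: y; apply: nbhs_pinfty_ge; exact: num_real.
Unshelve. all: end_near. Qed.

(** * Lower bound on the density *)

(** The tangent inequality for the convex function [- ln (f (e ^ t))] at
    [t = ln y], in multiplicative form: the derivative of [f x * x ^ l] is a
    positive multiple of [l - L_fun f x], which changes sign from [+] to [-]
    at [x = y] when [l = L_fun f y]. *)
Lemma tangent_bound (R : realType) (f : R -> R) (x0 : R) :
  0 <= x0 ->
  (forall x, x0 < x -> 0 < f x /\ derivable f x 1) ->
  (forall x y, x0 < x -> x <= y -> L_fun f x <= L_fun f y) ->
  forall x y, x0 < x -> x0 < y ->
  f x * x `^ L_fun f y <= f y * y `^ L_fun f y.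
Proof.
move=> x00 fd fL x y x0x x0y; set l := L_fun f y.
pose g z := f z * z `^ l.
have gd z : x0 < z ->
    is_derive z 1 g (f z * z `^ (l - 1) * (l - L_fun f z)).
  move=> x0z; have z0 : 0 < z by exact: le_lt_trans x0z.
  have [fz fdz] := fd _ x0z.
  have fD : is_derive z 1 f ('D_1 f z) by exact: derivableP.
  have pD := is_derive1_powR l z0.
  have gD : is_derive z 1 g _ := is_deriveM fD pD.
  apply: (is_derive_eq gD).
  have -> : z `^ l = z `^ (l - 1) * z.
    by rewrite -[X in _ = _ * X](powRr1 (ltW z0)) -powRD_gt0// subrK.
  rewrite /L_fun derive1E /GRing.scale/=; field.
  by rewrite gt_eqF.
have gc a b : x0 < a -> {within `[a, b], continuous g}.
  move=> x0a; apply: continuous_in_subspaceT => z.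
  rewrite inE/= in_itv/= => /andP[az _].
  apply/differentiable_continuous/derivable1_diffP/ex_derive/gd.
  exact: lt_le_trans az.
have [xy|yx] := leP x y.
  apply: (@ger0_derive1_le_cc _ g x y _ _ (gc _ _ x0x) x y); rewrite ?in_itv/= ?lexx ?xy//.
    by move=> z /[!in_itv]/= /andP[xz _]; apply/ex_derive/gd/(lt_trans x0x).
  move=> z /[!in_itv]/= /andP[xz zy]; have x0z := lt_trans x0x xz.
  have gdz := gd _ x0z.
  rewrite derive1E derive_val mulr_ge0//.
    by rewrite mulr_ge0 ?powR_ge0// ltW//; case: (fd _ x0z).
  by rewrite subr_ge0 fL// ltW.
apply: (@ler0_derive1_le_cc _ g y x _ _ (gc _ _ x0y) x y); rewrite ?in_itv/= ?lexx ?(ltW yx)//.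
  by move=> z /[!in_itv]/= /andP[xz _]; apply/ex_derive/gd/(lt_trans x0y).
move=> z /[!in_itv]/= /andP[yz zx]; have x0z := lt_trans x0y yz.
have gdz := gd _ x0z.
rewrite derive1E derive_val mulr_ge0_le0//.
  by rewrite mulr_ge0 ?powR_ge0// ltW//; case: (fd _ x0z).
by rewrite subr_le0 fL// ltW.
Qed.

Lemma integral_oneDsqrV (R : realType) :
  (\int[lebesgue_measure]_(x in [set: R]) ((oneDsqr x)^-1)%:E = (pi : R)%:E)%E.
Proof.
rewrite ge0_symfun_integralT.
- rewrite -set_itvcy integral0y_oneDsqr -EFinM; congr EFin.
  by rewrite mulrC divfK.
- by move=> x; rewrite invr_ge0 (le_trans ler01)// oneDsqr_ge1.
- exact: continuous_oneDsqrV.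
- by move=> x; rewrite /= /oneDsqr sqrrN.
Qed.

(** A bound on [f x * x ^ (N + 2)], two orders above the moment, leaves the
    integrable weight [2 / (1 + x ^ 2)] for the tails. *)
Lemma even_moment_le (R : realType) (f : R -> R) (x0 K : R) (N : nat) :
  measurable_fun [set: R] f -> (forall x, 0 <= f x) ->
  (\int[lebesgue_measure]_(x in [set: R]) (f x)%:E = 1)%E ->
  (forall x, f (- x) = f x) -> ~~ odd N -> 1 <= x0 -> 0 <= K ->
  (forall x, x0 < x -> f x * x ^+ N.+2 <= K) ->
  (\int[lebesgue_measure]_(x in [set: R]) (x ^+ N * f x)%:E <=
     (x0 ^+ N + K * 2 * pi)%:E)%E.
Proof.
move=> mf f0 f1 fN evN x01 K0 fK.
have x00 : 0 <= x0 by apply: le_trans x01.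
have bnd x : 0 <= x -> x ^+ N * f x <= x0 ^+ N * f x + K * 2 * (oneDsqr x)^-1.
  move=> xge0.
  have o1 := oneDsqr_ge1 x; have o0 : 0 < oneDsqr x by apply: lt_le_trans o1.
  have [xx0|x0x] := leP x x0.
    rewrite -[leLHS]addr0 lerD//; first by rewrite ler_wpM2r// lerXn2r.
    by rewrite !mulr_ge0// invr_ge0 ltW.
  rewrite -[leLHS]add0r lerD//; first by rewrite mulr_ge0// exprn_ge0.
  rewrite ler_pdivlMr//; apply: le_trans (_ : f x * x ^+ N.+2 * 2 <= _); last first.
    by rewrite ler_wpM2r// fK.
  rewrite mulrC -addn2 exprD /oneDsqr.
  have -> : f x * (x ^+ N * x ^+ 2) * 2 = (2 * x ^+ 2) * (x ^+ N * f x) by ring.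
  rewrite ler_wpM2r ?mulr_ge0 ?exprn_ge0//.
  have : 1 <= x ^+ 2 by rewrite exprn_ege1// ltW// (le_lt_trans x01).
  lra.
have bnd' x : x ^+ N * f x <= x0 ^+ N * f x + K * 2 * (oneDsqr x)^-1.
  have [|xneg] := leP 0 x; first exact: bnd.
  have := bnd (- x); rewrite fN /oneDsqr sqrrN exprNn -signr_odd (negbTE evN).
  by rewrite expr0 mul1r; apply; rewrite oppr_ge0 ltW.
have oinv0 x : 0 <= (oneDsqr x)^-1 :> R.
  by rewrite invr_ge0 (le_trans ler01)// oneDsqr_ge1.
have mo : measurable_fun [set: R] (fun x : R => (oneDsqr x)^-1).
  by apply: continuous_measurable_fun; exact: continuous_oneDsqrV.
apply: (@le_trans _ _ (\int[lebesgue_measure]_(x in [set: R])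
   (x0 ^+ N * f x + K * 2 * (oneDsqr x)^-1)%:E)%E).
  apply: ge0_le_integral => //.
  - move=> x xT; rewrite lee_fin mulr_ge0//.
    by rewrite -(odd_double_half N) (negbTE evN) add0n -mul2n exprM exprn_ge0// sqr_ge0.
  - by apply/measurable_EFinP/measurable_funM.
  - by apply/measurable_EFinP/measurable_funD; exact: measurable_funM.
  - by move=> x _; rewrite lee_fin.
have scal k (g : R -> R) : 0 <= k -> measurable_fun [set: R] g ->
    (forall x, 0 <= g x) ->
    (\int[lebesgue_measure]_(x in [set: R]) (k * g x)%:E =
     k%:E * \int[lebesgue_measure]_(x in [set: R]) (g x)%:E)%E.
  move=> k0 mg g0; under eq_integral do rewrite EFinM.
  rewrite ge0_integralZl ?lee_fin//; first exact/measurable_EFinP.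
  by move=> x _; rewrite lee_fin.
under eq_integral do rewrite EFinD.
rewrite ge0_integralD//; first last.
- by apply/measurable_EFinP/measurable_funM.
- by move=> x _; rewrite lee_fin !mulr_ge0.
- by apply/measurable_EFinP/measurable_funM.
- by move=> x _; rewrite lee_fin mulr_ge0// exprn_ge0.
rewrite !scal// ?mulr_ge0// ?exprn_ge0//.
by rewrite f1 integral_oneDsqrV mule1 -EFinM -EFinD.
Qed.

(** For [y] large, [tangent_bound] bounds [x ^ (N + 2) * f x] by
    [K = f y * y ^ (L_fun f y)], where [N] is the even integer such that
    [N + 2 <= L_fun f y < N + 4]. The moment of order [N] is then at most a
    multiple of [K], up to the contribution [x0 ^ N] of a bounded interval,
    which is negligible against the assumed growth. Hence [f y] is at least a
    multiple of [N ^ ((1 + eps) * N) * y ^ (- N - 4)]; the worst possible [N]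
    in this bound is of order [y ^ (1 / (1 + eps))]. *)
Lemma density_lower_bound (R : realType) (f : R -> R) (c eps : R) :
  0 < c -> 0 < eps ->
  measurable_fun [set: R] f -> (forall x, 0 <= f x) ->
  (\int[lebesgue_measure]_(x in [set: R]) (f x)%:E = 1)%E ->
  (forall x, f (- x) = f x) -> condition_L f ->
  (forall k : nat, (0 < k)%N ->
    ((c * (2 * k)%:R `^ (2 * (1 + eps) * k%:R))%:E <=
     \int[lebesgue_measure]_(x in [set: R]) (x ^+ (2 * k) * f x)%:E)%E) ->
  exists c1 x1 : R, [/\ 0 < c1, 1 <= x1 & forall y, x1 <= y ->
    c1 * y ^- 4 * expR (- ((1 + eps) * y `^ (1 + eps)^-1)) <= f y].
Proof.
move=> c0 eps0 mf f0 f1 fN [z0 z00 [fd fL Linf]] grow.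
pose x0 := Num.max z0 1.
have x01 : 1 <= x0 by rewrite le_max lexx orbT.
have z0x0 : z0 <= x0 by rewrite le_max lexx.
have x0p : 0 < x0 by apply: lt_le_trans x01.
(* [N >= n0] gives [N ^ N >= (2 * x0) ^ N >= N * x0 ^ N >= (2 / c) * x0 ^ N], so
   that [x0 ^ N] is at most half of the lower bound on the moment. *)
pose n0 := 2 * x0 + 2 / c.
have [x1 [x0x1 Lx1]] : exists x1, x0 < x1 /\ forall y, x1 <= y -> n0 + 4 <= L_fun f y.
  have /cvgryPge/(_ (n0 + 4)) [M [_ HM]] := Linf.
  exists (Num.max x0 M + 1); split.
    by rewrite ltr_pwDr// le_max lexx.
  move=> y hy; apply: HM; apply: lt_le_trans hy.
  by rewrite ltr_pwDr// le_max lexx orbT.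
have n00 : 0 < n0 by rewrite addr_gt0 ?mulr_gt0 ?invr_gt0.
have pi0 : 0 < (pi : R) := pi_gt0 R.
exists (c / (4 * pi)), x1; split.
- by rewrite divr_gt0// mulr_gt0.
- by rewrite (le_trans x01)// ltW.
move=> y x1y; set l := L_fun f y.
have x0y : x0 < y by apply: lt_le_trans x1y.
have y1 : 1 <= y by rewrite (le_trans x01)// ltW.
have y0 : 0 < y by apply: lt_le_trans y1.
have ln0 : n0 + 4 <= l by exact: Lx1.
pose k := Num.truncn ((l - 2) / 2); pose N := (2 * k)%N.
have /andP[kl lk] : k%:R <= (l - 2) / 2 < k.+1%:R.
  by apply: truncn_itv; lra.
have NE : N%:R = 2 * k%:R :> R by rewrite natrM.
have Nl : N%:R + 2 <= l by rewrite NE; lra.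
have lN : l <= N%:R + 4 by rewrite NE; move: lk; rewrite -(natr1 k); lra.
have Nn0 : n0 <= N%:R by lra.
have N0 : 0 < N%:R :> R by apply: lt_le_trans Nn0.
have k0 : (0 < k)%N by move: N0; rewrite ltr0n muln_gt0 => /andP[].
pose K := f y * y `^ l.
have K0 : 0 <= K by rewrite mulr_ge0// powR_ge0.
have fK x : x0 < x -> f x * x ^+ N.+2 <= K.
  move=> x0x; have x1' : 1 <= x by rewrite (le_trans x01)// ltW.
  apply: (@le_trans _ _ (f x * x `^ l)).
    rewrite ler_wpM2l// -powR_mulrn ?(le_trans _ x1')// ler_powR//.
    by move: Nl; rewrite -(addn2 N) natrD.
  by rewrite /K /l; apply: (tangent_bound (ltW z00) fd fL); apply: le_lt_trans z0x0 _.
have := grow _ k0; rewrite -/N => /le_trans/(_ (even_moment_le mf f0 f1 fN _ x01 K0 fK)).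
have -> : ~~ odd N by rewrite oddM.
move=> /(_ isT); rewrite lee_fin.
have -> : 2 * (1 + eps) * k%:R = N%:R * (1 + eps) by rewrite NE; ring.
set W := N%:R `^ _ => cW.
have WN : N%:R ^+ N <= W.
  rewrite -powR_mulrn ?(ltW N0)// ler_powR//.
    by rewrite ler1n -(ltr0n R).
  by rewrite ler_peMr ?ltW//; lra.
have x0W : x0 ^+ N <= c / 2 * W.
  rewrite mulrC -ler_pdivrMr ?divr_gt0// invf_div.
  apply: le_trans WN; apply: (@le_trans _ _ ((2 * x0) ^+ N)).
    rewrite exprMn mulrC ler_wpM2r ?exprn_ge0 ?(ltW x0p)//.
    apply: (@le_trans _ _ N%:R); first by rewrite (le_trans _ Nn0)// /n0 lerDr mulr_ge0// ltW.
    by rewrite -natrX ler_nat ltnW// ltn_expl.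
  rewrite lerXn2r ?nnegrE ?mulr_ge0 ?(ltW N0) ?(ltW x0p)//.
  by rewrite (le_trans _ Nn0)// /n0 lerDl divr_ge0// ltW.
have cWK : c / (4 * pi) * W <= K.
  rewrite mulrAC ler_pdivrMr ?mulr_gt0//; move: cW x0W; lra.
have KN : K <= f y * (y ^+ 4 * y ^+ N).
  rewrite ler_wpM2l// -exprD -powR_mulrn ?(ltW y0)// ler_powR//.
  by rewrite natrD addrC.
have fyW : c / (4 * pi) * y ^- 4 * (W / y ^+ N) <= f y.
  rewrite mulrACA -invfM ler_pdivrMr ?mulr_gt0 ?exprn_gt0//.
  exact: le_trans KN.
apply: le_trans fyW.
apply: ler_wpM2l.
  apply/ltW/divr_gt0; last exact: exprn_gt0.
  by apply: divr_gt0 => //; exact: mulr_gt0.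
have e0 : 0 < 1 + eps by rewrite addr_gt0.
pose Y := y `^ (1 + eps)^-1.
have Y0 : 0 < Y by exact: powR_gt0.
have -> : W / y ^+ N = expR ((1 + eps) * N%:R * (ln N%:R - ln Y)).
  rewrite -[LHS]lnK ?posrE ?divr_gt0 ?exprn_gt0 ?powR_gt0//.
  congr expR; rewrite ln_div ?posrE ?exprn_gt0 ?powR_gt0//.
  rewrite lnXn// !ln_powR -mulr_natr; field.
  by rewrite gt_eqF.
(* It remains to see that [N * ln (Y / N) <= Y]. *)
rewrite ler_expR -/Y -mulrA -mulrN ler_pM2l//.
rewrite -opprB mulrN lerN2 mulrC -ler_pdivlMr// -ln_div ?posrE//.
exact/ltW/ln_sublinear/divr_gt0.
Qed.

(** * The truncated quadratic and the damped oscillations *)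

(** The variable [u] of the half-line, as a function of [x]; the truncation at
    [0] extends functions of [u] by their value at [0] to [|x| <= a]. *)
Definition gap (R : realType) (a x : R) : R := Num.max 0 (x ^+ 2 - a ^+ 2).

Lemma gap_ge0 (R : realType) (a x : R) : 0 <= gap a x.
Proof. by rewrite le_max lexx. Qed.

Lemma gapE (R : realType) (a x : R) : 0 <= a -> a <= x ->
  gap a x = x ^+ 2 - a ^+ 2.
Proof.
move=> a0 ax; apply/max_idPr; rewrite subr_ge0 lerXn2r// nnegrE.
exact: le_trans ax.
Qed.

Lemma gap_eq0 (R : realType) (a x : R) : `|x| <= a -> gap a x = 0.
Proof.
move=> xa; apply/max_idPl; rewrite subr_le0 -real_normK ?num_real//.
by rewrite lerXn2r// nnegrE// (le_trans _ xa).
Qed.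

Lemma gapN (R : realType) (a x : R) : gap a (- x) = gap a x.
Proof. by rewrite /gap sqrrN. Qed.

Lemma continuous_powR_max (R : realType) (b : R) : 0 < b ->
  continuous (fun y : R => Num.max 0 y `^ b).
Proof.
move=> b0 y; have [y0|y0] := ltP 0 y.
  have cy : {for y, continuous (fun z : R => z `^ b)}.
    apply/differentiable_continuous/derivable1_diffP/ex_derive.
    exact: is_derive1_powR.
  have {}cy : z `^ b @[z --> y] --> y `^ b by exact: cy.
  rewrite /continuous_at (max_idPr (ltW y0)).
  apply: cvg_trans cy; apply: near_eq_cvg; near=> z => /=.
  by rewrite max_r// ltW//; near: z; exact: lt_nbhsr.
rewrite /continuous_at (max_idPl y0) powR0 ?gt_eqF//.
apply/cvgr0Pnorm_le => e e0; near=> z.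
rewrite ger0_norm ?powR_ge0//.
have -> : e = (e `^ b^-1) `^ b by rewrite -powRrM mulVf ?gt_eqF// powRr1// ltW.
rewrite ge0_ler_powR ?nnegrE ?powR_ge0 ?(ltW b0)// ?le_max ?lexx//.
rewrite ge_max powR_ge0/= ltW//; near: z; apply: lt_nbhsl.
by rewrite (le_lt_trans y0)// powR_gt0.
Unshelve. all: end_near. Qed.

Lemma continuous_sqrB (R : realType) (a : R) :
  continuous (fun x : R => x ^+ 2 - a ^+ 2).
Proof. by move=> x; apply: cvgB; [exact: exprn_continuous|exact: cvg_cst]. Qed.

Lemma continuous_gap (R : realType) (a : R) : continuous (gap a).
Proof.
move=> x.
apply: (@continuous_max _ _ (cst 0) (fun x : R => x ^+ 2 - a ^+ 2)).
  exact: cvg_cst.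
exact: continuous_sqrB.
Qed.

Lemma continuous_gap_powR (R : realType) (a b : R) : 0 < b ->
  continuous (fun x => gap a x `^ b).
Proof.
move=> b0 x.
exact: (continuous_comp (@continuous_sqrB R a x) (@continuous_powR_max R b b0 _)).
Qed.

Lemma is_derive_pow (R : realType) (f : R -> R) (x df : R) (n : nat) :
  is_derive x 1 f df ->
  is_derive x 1 (fun x => f x ^+ n.+1) (n.+1%:R * f x ^+ n * df).
Proof.
move=> fD.
rewrite (_ : (fun x => _) = f ^+ n.+1); last by apply/funext => z; rewrite !fctE.
exact: is_derive_eq (is_deriveX n.+1 fD) _.
Qed.

Lemma is_derive_gap (R : realType) (a x : R) : 0 <= a -> a < x ->
  is_derive x 1 (gap a) (2 * x).
Proof.
move=> a0 ax.
apply: (@near_eq_is_derive _ _ _ (fun x : R => x ^+ 2 - a ^+ 2)).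
  near=> z; apply/esym/gapE => //.
  by apply/ltW; near: z; exact: lt_nbhsr.
have xD : is_derive x 1 (fun x : R => x ^+ 2) _ := is_derive_pow 1 (is_derive_id x 1).
apply: is_derive_eq (is_deriveB xD (is_derive_cst (a ^+ 2) x 1)) _.
by rewrite subr0 expr1 mulr1.
Unshelve. all: end_near. Qed.

Lemma is_derive_gap_powR (R : realType) (a b x : R) : 0 <= a -> a < x ->
  is_derive x 1 (fun x => gap a x `^ b) (b * gap a x `^ (b - 1) * (2 * x)).
Proof.
move=> a0 ax.
have g0 : 0 < gap a x.
  by rewrite gapE ?(ltW ax)// subr_gt0 ltrXn2r// nnegrE// (le_trans a0)// ltW.
exact: (is_derive1_comp (is_derive1_powR b g0) (is_derive_gap a0 ax)).
Qed.

(** [damped_sin s t p] and [damped_cos s t p] are the imaginary and real parts of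
    [e ^ (i * p * t) * exp (- s * e ^ (i * t))].
    The factor [e ^ (i * p * t)] undoes the rotation, so that the Gamma integral
    of this function does not depend on [t]. *)
Definition damped_sin (R : realType) (s t p : R) : R :=
  expR (- (s * cos t)) * sin (p * t - s * sin t).
Definition damped_cos (R : realType) (s t p : R) : R :=
  expR (- (s * cos t)) * cos (p * t - s * sin t).

Lemma is_derive_damped_sin (R : realType) (s t p : R) :
  is_derive t 1 (fun t => damped_sin s t p)
    (s * sin t * damped_sin s t p + (p - s * cos t) * damped_cos s t p).
Proof.
have e1 : is_derive t 1 (fun t : R => - (s * cos t)) _ :=
  is_deriveN (is_deriveZ s (is_derive_cos t)).
have e2 : is_derive t 1 (fun t : R => p * t - s * sin t) _ :=
  is_deriveB (is_deriveZ p (is_derive_id t 1)) (is_deriveZ s (is_derive_sin t)).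
have d1 := is_derive1_comp (is_derive_expR _) e1.
have d2 := is_derive1_comp (is_derive_sin _) e2.
apply: is_derive_eq (is_deriveM d1 d2) _.
rewrite /damped_sin /damped_cos /GRing.scale/= /comp; ring.
Qed.

(** With [s = (gap a x) ^ b] and [b * p = i + 1], the factor in front of
    [damped_cos] is [s ^ p], and the derivative found here is the one of
    [is_derive_damped_sin] times [2 * x * (gap a x) ^ i * b], the Jacobian of
    [x |-> s] times [s ^ (p - 1)]. *)
Lemma is_derive_damped_cos (R : realType) (a b t p x : R) (i : nat) :
  0 <= a -> a < x ->
  is_derive x 1 (fun x => gap a x ^+ i.+1 * damped_cos (gap a x `^ b) t p)
    (2 * x * gap a x ^+ i * (i.+1%:R * damped_cos (gap a x `^ b) t p +
      b * gap a x `^ b * (sin t * damped_sin (gap a x `^ b) t p -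
                          cos t * damped_cos (gap a x `^ b) t p))).
Proof.
move=> a0 ax.
have g0 : 0 < gap a x.
  by rewrite gapE ?(ltW ax)// subr_gt0 ltrXn2r// nnegrE// (le_trans a0)// ltW.
have sD := is_derive_gap_powR b a0 ax.
have e1 : is_derive x 1 (fun x : R => - (gap a x `^ b * cos t)) _ :=
  is_deriveN (is_deriveM sD (is_derive_cst (cos t) x 1)).
have e2 : is_derive x 1 (fun x : R => p * t - gap a x `^ b * sin t) _ :=
  is_deriveB (is_derive_cst (p * t) x 1) (is_deriveM sD (is_derive_cst (sin t) x 1)).
have d1 := is_derive1_comp (is_derive_expR _) e1.
have d2 := is_derive1_comp (is_derive_cos _) e2.
have d3 : is_derive x 1 (fun x => gap a x ^+ i.+1) _ :=
  is_derive_pow i (is_derive_gap a0 ax).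
apply: is_derive_eq (is_deriveM d3 (is_deriveM d1 d2)) _.
rewrite /damped_sin /damped_cos /GRing.scale/= /comp exprS /cst.
rewrite ?fctE.
have -> : gap a x `^ b = gap a x * gap a x `^ (b - 1).
  by rewrite -[X in _ = X * _](powRr1 (ltW g0)) -powRD_gt0// addrC subrK.
ring.
Qed.

(** * Rotating the half-line of integration *)

Lemma continuous_exprM_gap (R : realType) (a : R) (i : nat) (g : R -> R) :
  continuous g -> continuous (fun x : R => 2 * x * gap a x ^+ i * g x).
Proof.
move=> cg x; apply: cvgM; last exact: cg.
apply: cvgM; last first.
  exact: (continuous_comp (@continuous_gap R a x) (@exprn_continuous R i _)).
by apply: cvgM; [exact: cvg_cst|exact: cvg_id].
Qed.

Lemma continuous_damped_arg (R : realType) (a b t p : R) : 0 < b ->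
  continuous (fun x : R => p * t - gap a x `^ b * sin t).
Proof.
move=> b0 x; apply: cvgB; first exact: cvg_cst.
apply: cvgM; last exact: cvg_cst.
exact: continuous_gap_powR.
Qed.

Lemma continuous_damped_exp (R : realType) (a b t : R) : 0 < b ->
  continuous (fun x : R => expR (- (gap a x `^ b * cos t))).
Proof.
move=> b0 x.
have H : {for x, continuous (fun x : R => - (gap a x `^ b * cos t))}.
  apply: cvgN; apply: cvgM; last exact: cvg_cst.
  exact: continuous_gap_powR.
exact: (continuous_comp H (@continuous_expR R _)).
Qed.

Lemma continuous_damped_sin (R : realType) (a b t p : R) : 0 < b ->
  continuous (fun x : R => damped_sin (gap a x `^ b) t p).
Proof.
move=> b0 x; apply: cvgM; first exact: continuous_damped_exp.
exact: (continuous_comp (@continuous_damped_arg R a b t p b0 x) (@continuous_sin R _)).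
Qed.

Lemma continuous_damped_cos (R : realType) (a b t p : R) : 0 < b ->
  continuous (fun x : R => damped_cos (gap a x `^ b) t p).
Proof.
move=> b0 x; apply: cvgM; first exact: continuous_damped_exp.
exact: (continuous_comp (@continuous_damped_arg R a b t p b0 x) (@continuous_cos R _)).
Qed.

Lemma continuous_itv_integrable (R : realType) (f : R -> R) (a c : R) :
  continuous f -> (@lebesgue_measure R).-integrable `[a, c] (EFin \o f).
Proof.
move=> cf; apply: continuous_compact_integrable; first exact: segment_compact.
exact: continuous_subspaceT.
Qed.

(** Differentiating under the integral sign gives the integral of an exact
    derivative in [x], hence a boundary term; the one at [a] vanishes. *)
Lemma is_derive_rotated_integral (R : realType) (a b c p t : R) (i : nat) :
  0 <= a -> a < c -> 0 < b -> b * p = i.+1%:R ->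
  is_derive t 1
    (fun t => \int[lebesgue_measure]_(x in `[a, c])
       (2 * x * gap a x ^+ i * (b * damped_sin (gap a x `^ b) t p)))
    (gap a c ^+ i.+1 * damped_cos (gap a c `^ b) t p).
Proof.
move=> a0 ac b0 bp.
pose F t x := 2 * x * gap a x ^+ i * (b * damped_sin (gap a x `^ b) t p).
pose dF t x := 2 * x * gap a x ^+ i *
  (b * (gap a x `^ b * sin t * damped_sin (gap a x `^ b) t p +
       (p - gap a x `^ b * cos t) * damped_cos (gap a x `^ b) t p)).
have FD (s x : R) : is_derive s 1 (F ^~ x) (dF s x).
  have := is_derive_damped_sin (gap a x `^ b) s p => D.
  exact: (is_deriveZ (2 * x * gap a x ^+ i) (is_deriveZ b D)).
have d1E (s x : R) : partial1of2 F s x = dF s x.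
  by rewrite partial1of2E; have := FD s x => D; rewrite derive_val.
have cds s : continuous (fun x : R => damped_sin (gap a x `^ b) s p).
  exact: continuous_damped_sin.
have cdc s : continuous (fun x : R => damped_cos (gap a x `^ b) s p).
  exact: continuous_damped_cos.
have cgp : continuous (fun x : R => gap a x `^ b) by exact: continuous_gap_powR.
have cF s : continuous (F s).
  apply: continuous_exprM_gap => x; apply: cvgM; [exact: cvg_cst|exact: cds].
have cdF s : continuous (dF s).
  apply: continuous_exprM_gap => x; apply: cvgM; first exact: cvg_cst.
  apply: cvgD; apply: cvgM.
  - by apply: cvgM; [exact: cgp|exact: cvg_cst].
  - exact: cds.
  - by apply: cvgB; [exact: cvg_cst|apply: cvgM; [exact: cgp|exact: cvg_cst]].
  - exact: cdc.
(* A bound on [dF] that does not depend on the angle. *)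
pose G x := `|2 * x * gap a x ^+ i * (b * ((gap a x `^ b + (`|p| + gap a x `^ b)) *
  expR (gap a x `^ b)))|.
have cG : continuous G.
  move=> x; apply: cvg_norm; apply: continuous_exprM_gap => {}x.
  apply: cvgM; first exact: cvg_cst.
  apply: cvgM; last exact: (continuous_comp (cgp x) (@continuous_expR R _)).
  apply: cvgD; first exact: cgp.
  by apply: cvgD; [exact: cvg_cst|exact: cgp].
have ds_le (s y q : R) : 0 <= y -> `|damped_sin y s q| <= expR y.
  move=> y0; rewrite normrM gtr0_norm ?expR_gt0// -[leRHS]mulr1.
  apply: ler_pM; [exact: expR_ge0|exact: normr_ge0| |exact: sin_max].
  rewrite ler_expR -mulrN; exact: ler_piMr.
have dc_le (s y q : R) : 0 <= y -> `|damped_cos y s q| <= expR y.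
  move=> y0; rewrite normrM gtr0_norm ?expR_gt0// -[leRHS]mulr1.
  apply: ler_pM; [exact: expR_ge0|exact: normr_ge0| |exact: cos_max].
  rewrite ler_expR -mulrN; exact: ler_piMr.
have dFG (s x : R) : `|dF s x| <= G x.
  rewrite /dF /G [leLHS]normrM [leRHS]normrM ler_wpM2l//.
  rewrite [leLHS]normrM [leRHS]normrM ler_wpM2l//.
  set y := gap a x `^ b; have y0 : 0 <= y by exact: powR_ge0.
  rewrite [leRHS]ger0_norm; last by rewrite mulr_ge0 ?expR_ge0 ?addr_ge0.
  rewrite [leRHS]mulrDl; apply: le_trans (ler_normD _ _) _; apply: lerD.
    rewrite normrM; apply: ler_pM; [exact: normr_ge0|exact: normr_ge0| |].
      by rewrite normrM (ger0_norm y0); apply: ler_piMr => //; exact: sin_max.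
    exact: ds_le.
  rewrite normrM; apply: ler_pM; [exact: normr_ge0|exact: normr_ge0| |].
    apply: le_trans (ler_normB _ _) _; rewrite lerD2l.
    by rewrite normrM (ger0_norm y0); apply: ler_piMr => //; exact: cos_max.
  exact: dc_le.
have tI : `]t - 1, t + 1[%classic t.
  by rewrite /= in_itv/= ltrBlDr ltrDl ltr01.
have iF (s : R) : `]t - 1, t + 1[%classic s ->
    (@lebesgue_measure R).-integrable `[a, c] (EFin \o F s).
  by move=> _; exact: continuous_itv_integrable.
have dFd (s x : R) : `]t - 1, t + 1[%classic s -> `[a, c]%classic x ->
    derivable (F ^~ x) s 1.
  by move=> _ _; have := FD s x => D; exact: ex_derive.
have iG : (@lebesgue_measure R).-integrable `[a, c] (EFin \o G).
  exact: continuous_itv_integrable.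
have G_ub (s x : R) : `]t - 1, t + 1[%classic s -> `[a, c]%classic x ->
    `|partial1of2 F s x| <= G x.
  by move=> _ _; rewrite d1E.
have G0 (x : R) : 0 <= G x by exact: normr_ge0.
have mac : measurable (`[a, c]%classic : set (measurableTypeR R)) by exact: measurable_itv.
have Kd := derivable_under_integral mac tI iF dFd G0 iG G_ub.
have KE := differentiation_under_integral mac tI iF dFd G0 iG G_ub.
apply: DeriveDef => //.
rewrite -derive1E KE.
under eq_Rintegral do rewrite d1E.
pose P x := gap a x ^+ i.+1 * damped_cos (gap a x `^ b) t p.
have cP : continuous P.
  move=> x; apply: cvgM; last exact: cdc.
  exact: (continuous_comp (@continuous_gap R a x) (@exprn_continuous R i.+1 _)).
have PD (x : R) : a < x -> is_derive x 1 P (dF t x).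
  move=> ax; apply: is_derive_eq (is_derive_damped_cos b t p i a0 ax) _.
  rewrite /dF -bp; ring.
rewrite /Rintegral (@continuous_FTC2 _ _ P)//.
- have -> : P a = 0 by rewrite /P gap_eq0 ?(ger0_norm a0)// expr0n mul0r.
  by rewrite sube0.
- exact: continuous_subspaceT.
- split.
  + by move=> x /[!in_itv]/= /andP[ax _]; have := PD _ ax => D; exact: ex_derive.
  + by apply: cvg_at_right_filter; exact: cP.
  + by apply: cvg_at_left_filter; exact: cP.
- move=> x /[!in_itv]/= /andP[ax _]; have := PD _ ax => D.
  by rewrite derive1E derive_val.
Qed.

(** At the angle [0] the integrand is zero, so the mean value theorem bounds the
    integral at the angle [pi * b] by the boundary term of
    [is_derive_rotated_integral], whose damping is the weakest at [pi * b].
    The value [p = (i + 1) / b] makes [p * pi * b] a multiple of [pi], which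
    turns [damped_sin _ _ p] into [damped_sin _ _ 0] up to sign. *)
Lemma truncated_moment_le (R : realType) (a b c : R) (i : nat) :
  0 <= a -> a < c -> 0 < b -> b < 2^-1 ->
  `|\int[lebesgue_measure]_(x in `[a, c])
      (2 * x * gap a x ^+ i * damped_sin (gap a x `^ b) (pi * b) 0)| <=
  pi * (gap a c ^+ i.+1 * expR (- (gap a c `^ b * cos (pi * b)))).
Proof.
move=> a0 ac b0 b2.
have pi0 := pi_gt0 R.
pose p := i.+1%:R / b; have bp : b * p = i.+1%:R by rewrite /p mulrC divfK// gt_eqF.
pose K t := \int[lebesgue_measure]_(x in `[a, c])
  (2 * x * gap a x ^+ i * (b * damped_sin (gap a x `^ b) t p)).
have KD (t : R) : is_derive t 1 K (gap a c ^+ i.+1 * damped_cos (gap a c `^ b) t p).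
  exact: is_derive_rotated_integral.
have th0 : 0 < pi * b by rewrite mulr_gt0.
have K0 : K 0 = 0.
  rewrite /K; under eq_Rintegral do rewrite /damped_sin sin0 !mulr0 subrr sin0 !mulr0.
  by rewrite Rintegral_cst// mul0r.
have cK : {within `[0, pi * b], continuous K}.
  apply: continuous_subspaceT => t; have := KD t => D.
  by apply/differentiable_continuous/derivable1_diffP/ex_derive.
have [z zth] := MVT th0 (fun t _ => KD t) cK.
rewrite K0 !subr0 => Kth.
have sgn : exists2 e : R, `|e| = 1 &
    forall y, sin (i.+1%:R * pi - y) = e * sin y.
  elim: (i.+1) => [|n [e e1 IH]].
    by exists (-1); rewrite ?normrN1// => y; rewrite mul0r sub0r sinN mulN1r.
  exists (- e); first by rewrite normrN.
  by move=> y; rewrite -natr1 mulrDl mul1r addrAC sinDpi IH mulNr.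
have [e e1 sE] := sgn.
have KE : K (pi * b) = - (e * b) * \int[lebesgue_measure]_(x in `[a, c])
      (2 * x * gap a x ^+ i * damped_sin (gap a x `^ b) (pi * b) 0).
  rewrite -RintegralZl//; last first.
    apply: continuous_itv_integrable; apply: continuous_exprM_gap.
    exact: continuous_damped_sin.
  apply: eq_Rintegral => x _; rewrite /damped_sin.
  have -> : p * (pi * b) = i.+1%:R * pi by rewrite -bp; ring.
  by rewrite mul0r sub0r sinN sE; ring.
set I := \int[_]_(x in _) _ in KE *.
have -> : `|I| = `|K (pi * b)| / b.
  rewrite KE normrM normrN normrM e1 mul1r (gtr0_norm b0).
  by rewrite mulrAC divff ?mul1r// gt_eqF.
rewrite Kth ler_pdivrMr// normrM (gtr0_norm th0) [leRHS]mulrAC [leRHS]mulrC.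
apply: ler_wpM2r; first exact: ltW.
move: zth; rewrite in_itv/= => /andP[z0 zth].
rewrite normrM ger0_norm ?exprn_ge0 ?gap_ge0//.
apply: ler_wpM2l; first by rewrite exprn_ge0// gap_ge0.
rewrite normrM gtr0_norm ?expR_gt0// -[leRHS]mulr1.
apply: ler_pM; [exact: expR_ge0|exact: normr_ge0| |exact: cos_max].
rewrite ler_expR lerN2 ler_wpM2l ?powR_ge0// ltW// ltr_cos// in_itv/=.
  by rewrite (ltW z0)/= (le_trans (ltW zth))// ler_piMr ?(ltW pi0)//; lra.
by rewrite (ltW th0)/= ler_piMr ?(ltW pi0)//; lra.
Qed.

(** * An even function whose moments vanish *)

Lemma damping_rate_gt0 (R : realType) (b : R) : 0 < b -> b < 2^-1 -> 0 < cos (pi * b).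
Proof.
move=> b0 b2; have pi0 := pi_gt0 R.
apply: cos_gt0_pihalf; rewrite (lt_trans (_ : _ < 0))/= ?mulr_gt0//.
  by rewrite ltr_pM2l.
by rewrite oppr_lt0 divr_gt0.
Qed.

Lemma gap_cvgy (R : realType) (a : R) : gap a n%:R @[n --> \oo] --> +oo.
Proof.
apply/cvgryPge => A; near=> n; rewrite le_max; apply/orP; right.
have n1 : 1 <= n%:R :> R by rewrite ler1n; near: n; exact: nbhs_infty_gt.
rewrite lerBrDr (@le_trans _ _ n%:R)//; last first.
  by rewrite expr2 ler_peMr// (le_trans ler01).
near: n; exact: nbhs_infty_ger.
Unshelve. all: end_near. Qed.

Lemma gap_damped_cvg0 (R : realType) (a b C : R) (m : nat) : 0 < b -> 0 < C ->
  gap a n%:R ^+ m * expR (- (gap a n%:R `^ b * C)) @[n --> \oo] --> (0 : R).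
Proof.
by move=> b0 C0; apply: cvg_comp (@gap_cvgy R a) (powR_expR_cvg0 m b0 C0).
Qed.

(** [truncated_moment_le] concerns powers of [gap a x = x ^ 2 - a ^ 2]; even
    powers of [x] are polynomials in it, which the induction on [j] exploits
    one factor [x ^ 2 = gap a x + a ^ 2] at a time. *)
Lemma truncated_even_moment_cvg0 (R : realType) (a b : R) (j : nat) :
  0 <= a -> 0 < b -> b < 2^-1 ->
  \int[lebesgue_measure]_(x in `[a, n%:R])
    (x ^+ (2 * j) * (x * damped_sin (gap a x `^ b) (pi * b) 0))
    @[n --> \oo] --> (0 : R).
Proof.
move=> a0 b0 b2; have pi0 := pi_gt0 R.
pose w x := damped_sin (gap a x `^ b) (pi * b) 0.
have cw : continuous w by exact: continuous_damped_sin.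
have cth : 0 < cos (pi * b) by exact: damping_rate_gt0.
suff H i : \int[lebesgue_measure]_(x in `[a, n%:R])
    (2 * x * gap a x ^+ i * (x ^+ (2 * j) * w x)) @[n --> \oo] --> (0 : R).
  rewrite -[X in _ --> X](mulr0 2^-1).
  rewrite (_ : (fun n => _) = fun n : nat => 2^-1 *
    \int[lebesgue_measure]_(x in `[a, n%:R])
    (2 * x * gap a x ^+ 0 * (x ^+ (2 * j) * w x))); last first.
    apply/funext => n; rewrite -RintegralZl//; last first.
      apply: continuous_itv_integrable; apply: continuous_exprM_gap => x.
      by apply: cvgM; [exact: exprn_continuous|exact: cw].
    by apply: eq_Rintegral => x _; rewrite /w expr0; field.
  by apply: cvgM; [exact: cvg_cst|exact: H].
have cxw l : continuous (fun x : R => x ^+ l * w x).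
  by move=> x; apply: cvgM; [exact: exprn_continuous|exact: cw].
elim: j i => [|j IH] i.
  apply/cvgr0Pnorm_le => e e0.
  have : pi * (gap a n%:R ^+ i.+1 * expR (- (gap a n%:R `^ b * cos (pi * b))))
      @[n --> \oo] --> (pi * 0 : R).
    by apply: cvgM; [exact: cvg_cst|exact: gap_damped_cvg0].
  rewrite mulr0 => /cvgr0Pnorm_le/(_ _ e0) He.
  near=> n.
  have an : a < n%:R by near: n; exact: nbhs_infty_gtr.
  under eq_Rintegral do rewrite muln0 expr0 mul1r.
  apply: le_trans (truncated_moment_le i a0 an b0 b2) _.
  by apply: le_trans (ler_norm _) _; near: n.
rewrite (_ : (fun n => _) = fun n : nat =>
    \int[lebesgue_measure]_(x in `[a, n%:R])
      (2 * x * gap a x ^+ i.+1 * (x ^+ (2 * j) * w x)) +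
    a ^+ 2 * \int[lebesgue_measure]_(x in `[a, n%:R])
      (2 * x * gap a x ^+ i * (x ^+ (2 * j) * w x))); last first.
  apply/funext => n; rewrite -RintegralZl//; last first.
    exact/continuous_itv_integrable/continuous_exprM_gap.
  rewrite -RintegralD//; last 2 first.
    exact/continuous_itv_integrable/continuous_exprM_gap.
    apply/continuous_itv_integrable => x; apply: cvgM; first exact: cvg_cst.
    exact: continuous_exprM_gap.
  apply: eq_Rintegral => x; rewrite inE/= in_itv/= => /andP[ax _].
  have -> : gap a x ^+ i.+1 = (x ^+ 2 - a ^+ 2) * gap a x ^+ i.
    by rewrite exprS gapE.
  rewrite mulnS (exprD x); ring.
rewrite -[X in _ --> X]addr0 -[X in _ --> _ + X](mulr0 (a ^+ 2)).
by apply: cvgD; [exact: IH|apply: cvgM; [exact: cvg_cst|exact: IH]].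
Unshelve. all: end_near. Qed.

Lemma Rintegral_itv_split (R : realType) (f : R -> R) (a b c : R) :
  continuous f -> a <= b -> b <= c ->
  \int[lebesgue_measure]_(x in `[a, c]) f x =
  \int[lebesgue_measure]_(x in `[a, b]) f x +
  \int[lebesgue_measure]_(x in `[b, c]) f x.
Proof.
move=> cf ab bc.
have itf : (@lebesgue_measure R).-integrable `[a, c] (EFin \o f).
  exact: continuous_itv_integrable.
rewrite -(@Rintegral_itv_obnd_cbnd _ b); last first.
  apply: integrableS itf => //; apply: subset_itvr.
  by rewrite bnd_simp.
by rewrite -(Rintegral_itvB itf) ?bnd_simp// addrC subrK.
Qed.

Lemma Rintegral_itv_sym (R : realType) (f : R -> R) (c : R) :
  continuous f -> 0 <= c ->
  \int[lebesgue_measure]_(x in `[- c, c]) f x =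
  \int[lebesgue_measure]_(x in `[0, c]) (f (- x) + f x).
Proof.
move=> cf c0; rewrite (Rintegral_itv_split cf (_ : _ <= 0) c0) ?oppr_le0//.
have cfN : continuous (fun x : R => f (- x)).
  move=> x; apply: (@continuous_comp _ _ _ -%R f); last exact: cf.
  exact: opp_continuous.
rewrite RintegralD//; last 2 first.
- exact: continuous_itv_integrable.
- exact: continuous_itv_integrable.
congr (_ + _); rewrite /Rintegral -[X in `[_, X]]oppr0.
by rewrite integration_by_substitution_oppr//; exact: continuous_subspaceT.
Qed.

Lemma Rintegral_cvg_itv (R : realType) (f : R -> R) :
  (@lebesgue_measure R).-integrable [set: R] (EFin \o f) ->
  \int[lebesgue_measure]_(x in `[- n%:R, n%:R]) f x @[n --> \oo] -->
  \int[lebesgue_measure]_(x in [set: R]) f x.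
Proof.
move=> fint; have mf := measurable_int _ fint.
pose fn (n : nat) : R -> \bar R := (EFin \o f) \_ `[- n%:R, n%:R].
have mfn n : measurable_fun [set: measurableTypeR R] (fn n).
  apply/(measurable_restrictT _ _).1; first exact: measurable_itv.
  exact: measurable_funTS.
have fn_cvg x : fn ^~ x @ \oo --> (EFin \o f) x.
  apply: cvg_near_cst; near=> n.
  rewrite /fn patchE mem_set//= in_itv/= -ler_norml.
  near: n; exact: nbhs_infty_ger.
have fn_le x n : (`|fn n x| <= `|(f x)%:E|)%E.
  by rewrite /fn patchE; case: ifP => // _; rewrite abse0 abse_ge0.
have ae1 : {ae @lebesgue_measure R, forall x, [set: R] x ->
    fn ^~ x @ \oo --> (EFin \o f) x}.
  by apply: aeW => x _; exact: fn_cvg.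
have ae2 : {ae @lebesgue_measure R, forall x n, [set: R] x ->
    (`|fn n x| <= `|(f x)%:E|)%E}.
  by apply: aeW => x n _; exact: fn_le.
have [_ _ H] := @dominated_convergence _ _ _ (@lebesgue_measure R) [set: R]
   measurableT fn (EFin \o f) (fun x => `|(f x)%:E|%E) mfn mf
   ae1 (integrable_abse fint) ae2.
have fin : (\int[lebesgue_measure]_(x in [set: R]) (EFin \o f) x)%E \is a fin_num.
  exact: integrable_fin_num.
rewrite -(fineK fin) in H; have {}H := fine_cvg H.
rewrite [X in X @ _ --> _](_ : _ = fine \o
  [sequence (\int[lebesgue_measure]_(x in [set: R]) fn n x)%E]_n); last first.
  by apply/funext => n; rewrite /Rintegral integral_mkcond.
exact: H.
Unshelve. all: end_near. Qed.

(** The factor [`|x|] is, up to the factor [2], the Jacobian of [gap a], made even. *)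
Definition wave (R : realType) (a b x : R) : R :=
  `|x| * damped_sin (gap a x `^ b) (pi * b) 0.

Lemma waveN (R : realType) (a b x : R) : wave a b (- x) = wave a b x.
Proof. by rewrite /wave normrN gapN. Qed.

Lemma continuous_wave (R : realType) (a b : R) : 0 < b -> continuous (wave a b).
Proof.
move=> b0 x; apply: cvgM; last exact: continuous_damped_sin.
exact: norm_continuous.
Qed.

Lemma wave_eq0 (R : realType) (a b x : R) : 0 < b -> `|x| <= a -> wave a b x = 0.
Proof.
move=> b0 xa; rewrite /wave /damped_sin gap_eq0// powR0 ?gt_eqF//.
by rewrite !mul0r subrr sin0 !mulr0.
Qed.

(** Odd moments vanish by symmetry, even ones by
    [truncated_even_moment_cvg0]. *)
Lemma Rintegral_wave_eq0 (R : realType) (a b : R) (k : nat) :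
  0 <= a -> 0 < b -> b < 2^-1 ->
  (@lebesgue_measure R).-integrable [set: R]
    (EFin \o (fun x => x ^+ k * wave a b x)) ->
  \int[lebesgue_measure]_(x in [set: R]) (x ^+ k * wave a b x) = 0.
Proof.
move=> a0 b0 b2 ig.
have cg l : continuous (fun x : R => x ^+ l * wave a b x).
  by move=> x; apply: cvgM; [exact: exprn_continuous|exact: continuous_wave].
have lim0 : \int[lebesgue_measure]_(x in `[- n%:R, n%:R]) (x ^+ k * wave a b x)
    @[n --> \oo] --> (0 : R).
  have [ok|ek] := boolP (odd k).
    apply: cvg_near_cst; apply: nearW => n.
    rewrite (Rintegral_itv_sym (cg k))//.
    under eq_Rintegral do rewrite waveN exprNn -signr_odd ok expr1 mulN1r mulNr addNr.
    by rewrite Rintegral_cst// mul0r.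
  have [j kj] : exists j, k = (2 * j)%N.
    by exists k./2; rewrite mul2n -[LHS]odd_double_half (negbTE ek).
  rewrite -[X in _ --> X](mulr0 2).
  have two : (2 : R) @[n --> \oo] --> (2 : R) by exact: cvg_cst.
  apply: cvg_trans (cvgM two (truncated_even_moment_cvg0 j a0 b0 b2)).
  apply: near_eq_cvg; near=> n => /=.
  have an : a <= n%:R by near: n; exact: nbhs_infty_ger.
  rewrite (Rintegral_itv_sym (cg k))//.
  under [RHS]eq_Rintegral do rewrite waveN exprNn -signr_odd (negbTE ek) expr0 mul1r -mulr2n.
  under [RHS]eq_Rintegral do rewrite -mulr_natl.
  rewrite [RHS]RintegralZl//; last exact/continuous_itv_integrable.
  congr (_ * _); rewrite (Rintegral_itv_split (cg k) a0 an).
  rewrite [X in X + _](_ : _ = 0) ?add0r; last first.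
    under eq_Rintegral => x.
      rewrite inE/= in_itv/= => /andP[x0 xa].
      rewrite wave_eq0 ?mulr0 ?ger0_norm//; over.
    by rewrite Rintegral_cst// mul0r.
  apply: eq_Rintegral => x; rewrite inE/= in_itv/= => /andP[ax _].
  by rewrite kj /wave ger0_norm// (le_trans a0).
exact: (cvg_unique _ (Rintegral_cvg_itv ig) lim0).
Unshelve. all: end_near. Qed.

(** Either [x ^ 2 <= 2 * a ^ 2] and the left-hand side is not positive, or
    [gap a x >= x ^ 2 / 2]. *)
Lemma gap_powR_ge (R : realType) (a b x : R) : 0 < a -> a <= x -> 0 < b ->
  2^-1 `^ b * x `^ (2 * b) - a `^ (2 * b) <= gap a x `^ b.
Proof.
move=> a0 ax b0; have x0 : 0 < x by apply: lt_le_trans ax.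
have sq y : 0 <= y -> y `^ (2 * b) = (y ^+ 2) `^ b.
  by move=> y0; rewrite powRrM powR_mulrn.
rewrite !sq ?(ltW x0) ?(ltW a0)// -powRM ?invr_ge0 ?sqr_ge0//.
have xx : 0 <= 2^-1 * x ^+ 2 by rewrite mulr_ge0// ltW// exprn_gt0.
have aa : 0 <= a ^+ 2 by rewrite ltW// exprn_gt0.
have [small|large] := leP (2^-1 * x ^+ 2) (a ^+ 2).
  apply: le_trans (powR_ge0 _ _); rewrite subr_le0.
  by apply: ge0_ler_powR => //; exact: ltW.
rewrite lerBlDr -[leLHS]addr0; apply: lerD; last exact: powR_ge0.
rewrite gapE// ?(ltW a0)//.
apply: ge0_ler_powR; rewrite ?nnegrE ?(ltW b0)//; last by lra.
by rewrite subr_ge0 lerXn2r// nnegrE ltW.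
Qed.

(** In logarithms, the claim is that [5 * ln x + A * x ^ al] is at most a
    positive multiple of [x ^ (2 * b)] plus a constant. *)
Lemma wave_dominated (R : realType) (a b al A c : R) :
  0 < a -> 0 < al -> al < 2 * b -> b < 2^-1 -> 0 <= A -> 0 < c ->
  exists2 dl : R, 0 < dl & forall x, a <= x ->
    dl * `|wave a b x| <= c * x ^- 4 * expR (- (A * x `^ al)).
Proof.
move=> a0 al0 alb b2 A0 c0.
have b0 : 0 < b by rewrite -(@pmulr_rgt0 _ 2)// (lt_trans al0).
pose C := cos (pi * b); have C0 : 0 < C by exact: damping_rate_gt0.
have B0 : 0 < C * 2^-1 `^ b by rewrite mulr_gt0// powR_gt0.
have A1 : 0 <= 5 * al^-1 + A by rewrite addr_ge0// mulr_ge0// invr_ge0 ltW.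
have [M HM] := powR_le_powR_add al0 alb A1 B0.
exists (c * expR (- (M + C * a `^ (2 * b)))); first by rewrite mulr_gt0// expR_gt0.
move=> x ax; have x0 : 0 < x by apply: lt_le_trans ax.
apply: (@le_trans _ _ (c * expR (- (M + C * a `^ (2 * b))) *
    (x * expR (- (gap a x `^ b * C))))).
  apply: ler_wpM2l; first by rewrite mulr_ge0 ?expR_ge0// ltW.
  rewrite normrM (gtr0_norm (_ : 0 < `|x|)) ?normr_gt0 ?gt_eqF//.
  rewrite (gtr0_norm x0); apply: ler_wpM2l; first exact: ltW.
  rewrite normrM (gtr0_norm (expR_gt0 _)) -[leRHS]mulr1.
  by apply: ler_wpM2l; [exact: expR_ge0|exact: sin_max].
rewrite -!mulrA; apply: ler_wpM2l; first exact: ltW.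
have -> : x ^- 4 = expR (- (4 * ln x)).
  by rewrite expRN (expRM_natl 4) lnK.
rewrite -{1}[x]lnK ?posrE// -!expRD ler_expR.
have := HM _ x0; have := ln_le_powR x0 al0.
have := gap_powR_ge a0 ax b0; rewrite -/C.
set y := gap a x `^ b; set u := x `^ (2 * b); set v := a `^ (2 * b).
set w := x `^ al; set q := 2^-1 `^ b => h1 h2 h3.
have h4 : C * (q * u - v) <= C * y by rewrite ler_pM2l.
move: h2 h3 h4; set r := al^-1 => h2 h3 h4.
have h5 : 5 * ln x <= 5 * (r * w) by rewrite ler_pM2l.
have e1 : (5 * r + A) * w = 5 * (r * w) + A * w by ring.
have e2 : C * q * u = C * (q * u) by ring.
have e3 : C * (q * u - v) = C * (q * u) - C * v by ring.
rewrite e1 e2 in h3; rewrite e3 in h4; rewrite (mulrC y C).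
lra.
Qed.

(** For [a < x < sqrt (a ^ 2 + 1)] the argument of the sine lies strictly
    between [0] and [1] in absolute value. *)
Lemma wave_neq0 (R : realType) (a b : R) : 0 < a -> 0 < b -> b < 2^-1 ->
  exists2 a', a < a' & forall x, a < x -> x < a' -> wave a b x != 0.
Proof.
move=> a0 b0 b2; have pi0 := pi_gt0 R.
exists (Num.sqrt (a ^+ 2 + 1)).
  rewrite -[ltLHS](gtr0_norm a0) -sqrtr_sqr ltr_sqrt ?ltrDl//.
  by rewrite addr_gt0// exprn_gt0.
move=> x ax xa'; have x0 : 0 < x by apply: lt_trans ax.
have a21 : 0 < a ^+ 2 + 1 by rewrite addr_gt0// exprn_gt0.
have x2 : x ^+ 2 < a ^+ 2 + 1.
  by rewrite -ltr_sqrt// sqrtr_sqr gtr0_norm.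
have g0 : 0 < gap a x.
  by rewrite gapE ?(ltW a0) ?(ltW ax)// subr_gt0 ltrXn2r ?nnegrE ?(ltW a0) ?(ltW x0).
have g1 : gap a x `^ b <= 1.
  rewrite [leRHS](_ : 1 = 1 `^ b); last by rewrite powR1.
  apply: ge0_ler_powR; rewrite ?nnegrE ?(ltW b0) ?(ltW g0)//.
  by rewrite gapE ?(ltW a0) ?(ltW ax)// lerBlDl ltW.
have sth : 0 < sin (pi * b).
  by apply: sin_gt0_pi; rewrite mulr_gt0//= gtr_pMr//; lra.
rewrite /wave /damped_sin mul0r sub0r sinN.
apply: mulf_neq0; first by rewrite normr_eq0 gt_eqF.
rewrite mulf_neq0 ?expR_eq0// oppr_eq0 gt_eqF//.
apply: sin_gt0_pi; rewrite mulr_gt0 ?powR_gt0//=.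
apply: (@le_lt_trans _ _ 1); last by apply: lt_le_trans (pi_ge2 R); rewrite ltr1n.
by rewrite mulr_ile1 ?powR_ge0 ?(ltW sth) ?sin_le1.
Qed.

(** * Densities and expectations *)

Lemma density_dominates d (T : measurableType d) (R : realType)
  (mu : {measure set T -> \bar R}) (nu : {measure set T -> \bar R}) (g : T -> R) :
  measurable_fun [set: T] g ->
  (forall A, measurable A -> nu A = (\int[mu]_(x in A) (g x)%:E)%E) ->
  nu `<< mu.
Proof.
move=> mg nuE; apply/null_content_dominatesP => A mA muA0.
rewrite nuE//; apply: null_set_integral => //.
exact/measurable_EFinP/measurable_funTS.
Qed.

(** By uniqueness, the density agrees almost everywhere with the Radon-Nikodym
    derivative, for which the change of variables is known. *)
Lemma ge0_integral_density d (T : measurableType d) (R : realType)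
  (mu : {sigma_finite_measure set T -> \bar R})
  (nu : {finite_measure set T -> \bar R}) (g phi : T -> R) :
  measurable_fun [set: T] g -> (forall x, 0 <= g x) ->
  (forall A, measurable A -> nu A = (\int[mu]_(x in A) (g x)%:E)%E) ->
  measurable_fun [set: T] phi -> (forall x, 0 <= phi x) ->
  (\int[nu]_(x in [set: T]) (phi x)%:E =
   \int[mu]_(x in [set: T]) (phi x * g x)%:E)%E.
Proof.
move=> mg g0 nuE mphi phi0.
have dom := density_dominates mg nuE.
rewrite -(Radon_Nikodym_SigmaFinite.change_of_variables dom)//; last first.
  exact/measurable_EFinP.
have mRN := measurable_int _ (Radon_Nikodym_SigmaFinite.f_integrable dom).
apply: ae_eq_integral => //.
- apply: emeasurable_funM => //; exact/measurable_EFinP.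
- exact/measurable_EFinP/measurable_funM.
- under [X in ae_eq _ _ _ X]eq_fun do rewrite EFinM.
  apply: ae_eqe_mul2l; apply: integral_ae_eq => //.
  + exact: Radon_Nikodym_SigmaFinite.f_integrable.
  + exact/measurable_EFinP.
  + by move=> E _ mE; rewrite -Radon_Nikodym_SigmaFinite.f_integral// nuE.
Qed.

Lemma integrable_densityP d (T : measurableType d) (R : realType)
  (mu : {sigma_finite_measure set T -> \bar R})
  (nu : {finite_measure set T -> \bar R}) (g phi : T -> R) :
  measurable_fun [set: T] g -> (forall x, 0 <= g x) ->
  (forall A, measurable A -> nu A = (\int[mu]_(x in A) (g x)%:E)%E) ->
  measurable_fun [set: T] phi ->
  nu.-integrable [set: T] (EFin \o phi) <->
  mu.-integrable [set: T] (fun x => (phi x * g x)%:E).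
Proof.
move=> mg g0 nuE mphi.
have E : (\int[nu]_(x in [set: T]) `|(phi x)%:E| =
    \int[mu]_(x in [set: T]) `|(phi x * g x)%:E|)%E.
  rewrite (ge0_integral_density (phi := fun x => `|phi x|) mg g0 nuE)//; last first.
    exact: measurableT_comp.
  by apply: eq_integral => x _; rewrite /= normrM (ger0_norm (g0 x)).
split => /integrableP[_ fin]; apply/integrableP; split.
- exact/measurable_EFinP/measurable_funM.
- by rewrite -E.
- exact/measurable_EFinP.
- by rewrite /= E.
Qed.

Lemma integral_density d (T : measurableType d) (R : realType)
  (mu : {sigma_finite_measure set T -> \bar R})
  (nu : {finite_measure set T -> \bar R}) (g phi : T -> R) :
  measurable_fun [set: T] g -> (forall x, 0 <= g x) ->
  (forall A, measurable A -> nu A = (\int[mu]_(x in A) (g x)%:E)%E) ->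
  nu.-integrable [set: T] (EFin \o phi) ->
  (\int[nu]_(x in [set: T]) (phi x)%:E =
   \int[mu]_(x in [set: T]) (phi x * g x)%:E)%E.
Proof.
move=> mg g0 nuE iphi.
have dom := density_dominates mg nuE.
rewrite -(Radon_Nikodym_change_of_variables dom)//.
have mphi := measurable_int _ iphi.
have mRN : measurable_fun [set: T] (Radon_Nikodym (charge_of_finite_measure nu) mu).
  by apply: (measurable_int mu); exact: Radon_Nikodym_integrable.
apply: ae_eq_integral => //.
- exact: emeasurable_funM.
- by apply/measurable_EFinP/measurable_funM => //; exact/measurable_EFinP.
- under [X in ae_eq _ _ _ X]eq_fun do rewrite EFinM.
  apply: ae_eqe_mul2l; apply: integral_ae_eq => //.
  + exact: Radon_Nikodym_integrable.
  + exact/measurable_EFinP.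
  + by move=> E _ mE; rewrite -Radon_Nikodym_integral//; exact: nuE.
Qed.

(** Borel sets of the real line are carried by two distinct measurable
    structures, the canonical one on [R] and the one on [measurableTypeR R] over
    which the Lebesgue measure is defined. Reading [X] as a random variable into
    the latter brings both measures of [ge0_integral_density] over one
    space. *)
Lemma transfer_density d (T : measurableType d) (R : realType)
    (P : probability T R) (X : T -> R) (g phi : R -> R) :
  measurable_fun [set: T] X ->
  measurable_fun [set: R] g -> (forall x, 0 <= g x) ->
  (forall A : set R, measurable A ->
    P (X @^-1` A) = (\int[lebesgue_measure]_(x in A) (g x)%:E)%E) ->
  measurable_fun [set: R] phi ->
  (P.-integrable [set: T] (EFin \o (phi \o X)) <->
   (@lebesgue_measure R).-integrable [set: R] (EFin \o (fun x => phi x * g x))) /\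
  (P.-integrable [set: T] (EFin \o (phi \o X)) ->
   (\int[P]_(t in [set: T]) (phi (X t))%:E =
    \int[lebesgue_measure]_(x in [set: R]) (phi x * g x)%:E)%E).
Proof.
move=> mX mg g0 PE mphi.
have mX' : measurable_fun [set: T] (X : T -> measurableTypeR R) by exact: mX.
have mphi' : measurable_fun [set: measurableTypeR R] (EFin \o phi).
  exact/measurable_EFinP.
pose X' : {mfun T >-> measurableTypeR R} :=
  HB.pack (X : T -> measurableTypeR R) (isMeasurableFun.Build _ _ _ _ _ mX').
pose nu := distribution P X'.
have intE : P.-integrable [set: T] (EFin \o (phi \o X)) <->
    nu.-integrable [set: measurableTypeR R] (EFin \o phi).
  split=> i; first exact: (integrable_pushforward mX' mphi' i).
  have /integrableP[_] := i; rewrite ge0_integral_distribution//; last first.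
    exact: measurableT_comp.
  move=> fin; apply/integrableP; split => //.
  by apply/measurable_EFinP; exact: measurableT_comp.
split.
  rewrite intE; exact: (@integrable_densityP _ (measurableTypeR R) R
    (@lebesgue_measure R) nu g phi mg g0 PE mphi).
move=> i; rewrite -(@integral_density _ (measurableTypeR R) R
  (@lebesgue_measure R) nu g phi mg g0 PE (intE.1 i)).
by rewrite (integral_distribution (X := X')).
Qed.

Lemma density_probability (R : realType) (g : R -> R) :
  (@lebesgue_measure R).-integrable [set: R] (EFin \o g) -> (forall x, 0 <= g x) ->
  (\int[lebesgue_measure]_(x in [set: R]) (g x)%:E = 1)%E ->
  exists nu : probability R R, forall A : set R, measurable A ->
    nu A = (\int[lebesgue_measure]_(x in A) (g x)%:E)%E.
Proof.
move=> ig g0 g1.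
pose m (A : set R) := (\int[lebesgue_measure]_(x in A) (g x)%:E)%E.
have m0 : m set0 = 0%E by rewrite /m integral_set0.
have mge0 A : (0 <= m A)%E by apply: integral_ge0 => x _; rewrite lee_fin.
have madd : semi_sigma_additive m.
  move=> /= A mA tA mUA; rewrite /m integral_bigcup//=; last first.
    by apply: (integrableS _ _ (subsetT _)).
  by apply: is_cvg_ereal_nneg_natsum_cond => n _ _; exact: mge0.
pose mM := isMeasure.Build _ R R m m0 mge0 madd.
pose mm : {measure set R -> \bar R} := HB.pack m mM.
pose mP := Measure_isProbability.Build _ R R mm g1.
pose nu : probability R R := HB.pack m mM mP.
by exists nu.
Qed.

Lemma ae_eq_itv (R : realType) (f g : R -> R) (a c : R) : a < c ->
  ae_eq (@lebesgue_measure R) [set: R] (EFin \o f) (EFin \o g) ->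
  exists x, [/\ a < x, x < c & f x = g x].
Proof.
move=> ac [N [mN N0 fgN]]; apply: contrapT => nex.
have sub : `]a, c[ `<=` N.
  move=> x /= /[!in_itv]/= /andP[ax xc]; apply: fgN => /= /(_ I) [fgx].
  by apply: nex; exists x.
have : (lebesgue_measure (`]a, c[%classic : set R) <= lebesgue_measure N)%E.
  by apply: le_measure => //; rewrite inE//; exact: measurable_itv.
rewrite [leRHS]N0 lebesgue_measure_itv/= lte_fin ac -EFinD lee_fin subr_le0.
by rewrite leNgt ac.
Qed.

(** The moments of [h] exist because [h] is dominated by [f]. *)
Lemma perturbed_density (R : realType) (f h : R -> R) :
  measurable_fun [set: R] f -> measurable_fun [set: R] h ->
  (forall x, `|h x| <= f x) ->
  (forall k, (@lebesgue_measure R).-integrable [set: R]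
     (EFin \o (fun x => x ^+ k * f x))) ->
  (forall k, \int[lebesgue_measure]_(x in [set: R]) (x ^+ k * h x) = 0) ->
  forall k, (@lebesgue_measure R).-integrable [set: R]
     (EFin \o (fun x => x ^+ k * (f x + h x))) /\
   (\int[lebesgue_measure]_(x in [set: R]) (x ^+ k * (f x + h x))%:E =
    \int[lebesgue_measure]_(x in [set: R]) (x ^+ k * f x)%:E)%E.
Proof.
move=> mf mh hf ifk h0 k.
have f0 x : 0 <= f x by exact: le_trans (hf x).
have ihk : (@lebesgue_measure R).-integrable [set: R] (EFin \o (fun x => x ^+ k * h x)).
  apply: (le_integrable _ _ _ (ifk k)) => //.
    by apply/measurable_EFinP/measurable_funM => //; exact: exprn_measurable.
  move=> x _; rewrite lee_fin !normrM (ger0_norm (f0 x)).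
  by apply: ler_wpM2l.
split.
  apply: eq_integrable (integrableD measurableT (ifk k) ihk) => // x _.
  by rewrite /= mulrDr EFinD.
under eq_integral do rewrite mulrDr EFinD.
rewrite (integralD measurableT (ifk k) ihk).
suff -> : (\int[lebesgue_measure]_(x in [set: R]) (x ^+ k * h x)%:E = 0)%E.
  by rewrite adde0.
rewrite -(fineK (integrable_fin_num _ ihk))//.
by congr EFin; exact: h0.
Qed.

(** * Indeterminacy *)

Theorem theorem4 (R : realType) (d : measure_display) (T : measurableType d)
    (P : probability T R) (X : {RV P >-> R}) (c eps : R) (f : R -> R)
    (hfin : finite_moments P X)
    (hc : 0 < c) (heps : 0 < eps)
    (hgrowth : forall k : nat, (0 < k)%N ->
      ((c * (2 * k)%:R `^ (2 * (1 + eps) * k%:R))%:E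
        <= moment P X (2 * k))%E)
    (hdens : is_density X f)
    (hsym : forall x : R, f (- x) = f x)
    (hL : condition_L f) :
  moment_indeterminate X.
Proof.
case: hdens => mf f0 distE det.
pose mu := @lebesgue_measure R.
have f1 : (\int[mu]_(x in [set: R]) (f x)%:E = 1)%E.
  by rewrite -distE//; exact: probability_setT.
have mpow k : measurable_fun [set: R] (fun x : R => x ^+ k) by exact: exprn_measurable.
have mX : measurable_fun [set: T] X by [].
have transf k := transfer_density mX mf f0 distE (mpow k).
have ifk k : mu.-integrable [set: R] (EFin \o (fun x => x ^+ k * f x)).
  apply: (transf k).1.1; case: k => [|k]; last exact: hfin.
  exact: finite_measure_integrable_cst.
have momE k : (0 < k)%N ->
    moment P X k = (\int[mu]_(x in [set: R]) (x ^+ k * f x)%:E)%E.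
  by move=> k0; rewrite /moment unlock; exact: (transf k).2 (hfin k k0).
have grow k : (0 < k)%N -> ((c * (2 * k)%:R `^ (2 * (1 + eps) * k%:R))%:E <=
    \int[mu]_(x in [set: R]) (x ^+ (2 * k) * f x)%:E)%E.
  by move=> k0; rewrite -momE ?muln_gt0//; exact: hgrowth.
have [c1 [a [c10 a1 flow]]] := density_lower_bound hc heps mf f0 f1 hsym hL grow.
have a0 : 0 < a by exact: lt_le_trans a1.
(* Any [b] with [al < 2 * b < 1] would do; this one makes [2 * b] the midpoint. *)
pose al := (1 + eps)^-1; pose b := (1 + al) / 4.
have e0 : 0 < 1 + eps by rewrite addr_gt0.
have al0 : 0 < al by rewrite invr_gt0.
have al1 : al < 1 by rewrite invf_lt1// ltrDl.
have b0 : 0 < b by rewrite divr_gt0// addr_gt0.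
have b2 : b < 2^-1 by rewrite /b; lra.
have alb : al < 2 * b by rewrite /b; lra.
have [dl dl0 Hdl] := wave_dominated a0 al0 alb b2 (ltW e0) c10.
pose h x := dl * wave a b x.
have hf x : `|h x| <= f x.
  wlog x0 : x / 0 <= x.
    move=> H; have [|xn] := leP 0 x; first exact: H.
    by have := H (- x); rewrite hsym /h waveN; apply; rewrite oppr_ge0 ltW.
  rewrite /h normrM (gtr0_norm dl0).
  have [xa|ax] := leP x a.
    by rewrite wave_eq0 ?normr0 ?mulr0// ger0_norm.
  by apply: le_trans (Hdl _ (ltW ax)) _; apply: flow; exact: ltW.
have ch : continuous h.
  by move=> x; apply: cvgM; [exact: cvg_cst|exact: continuous_wave].
have mh : measurable_fun [set: R] h by exact: continuous_measurable_fun.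
have h0 k : \int[mu]_(x in [set: R]) (x ^+ k * h x) = 0.
  have ih : mu.-integrable [set: R] (EFin \o (fun x => x ^+ k * wave a b x)).
    apply: (le_integrable _ _ _ (integrableZl measurableT dl^-1 (ifk k))) => //.
      apply/measurable_EFinP/measurable_funM => //.
      by apply: continuous_measurable_fun; exact: continuous_wave.
    move=> x _; rewrite /= lee_fin normrM [leRHS]normrM [X in _ <= _ * X]normrM [leRHS]mulrCA.
    apply: ler_wpM2l => //.
    rewrite (gtr0_norm (_ : 0 < dl^-1)) ?invr_gt0// ler_pdivlMl//.
    by have := hf x; rewrite /h normrM (gtr0_norm dl0) (ger0_norm (f0 x)).
  under eq_Rintegral do rewrite /h mulrCA.
  by rewrite RintegralZl// Rintegral_wave_eq0// ?mulr0// ltW.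
have pert := perturbed_density mf mh hf ifk h0.
pose g x := f x + h x.
have mg : measurable_fun [set: R] g by exact: measurable_funD.
have g0 x : 0 <= g x.
  by rewrite -lerBlDl sub0r lerNl (le_trans _ (hf x))// -normrN ler_norm.
have ig : mu.-integrable [set: R] (EFin \o g).
  by have := (pert 0%N).1; under eq_fun do rewrite expr0 mul1r.
have g1 : (\int[mu]_(x in [set: R]) (g x)%:E = 1)%E.
  have := (pert 0%N).2.
  under eq_integral do rewrite expr0 mul1r.
  by under [in X in _ = X -> _]eq_integral do rewrite expr0 mul1r; rewrite f1.
have [nu nuE] := density_probability ig g0 g1.
have midR : measurable_fun [set: R] (@idfun R) by exact: measurable_id.
have transf' k := transfer_density midR mg g0 nuE (mpow k).
have inu k : nu.-integrable [set: R] (EFin \o (fun x : R => x ^+ k)).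
  exact: (transf' k).1.2 (pert k).1.
have nuX A : measurable A -> nu A = distribution P X A.
  move=> mA; apply: det => // k k0; first exact: inu.
  rewrite momE// /moment unlock -(pert k).2.
  exact: (transf' k).2 (inu k).
have gf : ae_eq mu [set: R] (EFin \o g) (EFin \o f).
  apply: integral_ae_eq => //; first exact/measurable_EFinP.
  by move=> E _ mE; rewrite -nuE// nuX// distE.
have [a' aa' wave0] := wave_neq0 a0 b0 b2.
have [x [ax xa' gfx]] := ae_eq_itv aa' gf.
move/eqP: gfx; rewrite -subr_eq0 /g addrAC subrr add0r mulf_eq0 gt_eqF//=.
by apply/negP; exact: wave0.
Qed.
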